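(* For all $k\ge0$ the adjunction $M_{k+1}\dashv N_{k+1}$, with $N_{k+1}:\mathbf{Opd}_{k+1}\to\mathbf{Opd}_k$ the functor forgetting the $(k+1)$th dimension of operad structure, lifts to an adjunction $F_{k+1,k+1}\dashv G_{k+1,k+1}$, $$\mathbf{OWC}_{k+1,k+1}\ \underset{F_{k+1,k+1}}{\overset{G_{k+1,k+1}}{\rightleftarrows}}\ \mathbf{OWC}_{k+1,k},$$ where $G_{k+1,k+1}$ is the functor forgetting the $(k+1)$th dimension of operad structure, such that the following diagram serially commutes: writing $V:\mathbf{OWC}_{k+1,k+1}\to\mathbf{Opd}_{k+1}$ and $V':\mathbf{OWC}_{k+1,k}\to\mathbf{Opd}_k$ for the functors forgetting the contraction structure, $$V'\,G_{k+1,k+1}=N_{k+1}\,V\qquad\text{and}\qquad V\,F_{k+1,k+1}=M_{k+1}\,V'.$$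
   Context: A globular set $A$ consists of sets $A_k$ ($k\ge 0$) of $k$-cells and maps $s,t:A_{k}\to A_{k-1}$ ($k\ge1$) with $ss=st$ and $ts=tt$; morphisms commute with $s$ and $t$. The category is $\mathbf{GSet}$. Let $T$ be the free strict $\omega$-category monad on $\mathbf{GSet}$, with unit $\eta$ and multiplication $\mu$, and $1$ the terminal globular set. The category $\mathbf{Coll}$ of collections is $\mathbf{GSet}/T1$. It is monoidal: the tensor product of $d:A\to T1$ and $d':A'\to T1$ is the pullback $A\otimes A'$ of $d:A\to T1$ along $T!:TA'\to T1$, with structure map $A\otimes A'\to TA'\xrightarrow{Td'}T^21\xrightarrow{\mu_1}T1$; the unit is $\eta_1:1\to T1$. A (globular) operad is a monoid in $\mathbf{Coll}$. Two $k$-cells $a,b$ are parallel if $k=0$, or $k\ge1$ and $sa=sb$, $ta=tb$. A contraction $\gamma$ on a collection $d:A\to T1$ assigns, for every $k\ge0$, to every parallel pair $a,b\in A_k$ and every $(k+1)$-cell $\theta:da\to db$ of $T1$, a $(k+1)$-cell $\gamma_\theta(a,b):a\to b$ of $A$ with $d(\gamma_\theta(a,b))=\theta$. Morphisms preserving contractions satisfy $f(\gamma_\theta(a,b))=\gamma'_\theta(fa,fb)$. The underlying $k$-collection of a collection is obtained by discarding all cells of dimension $>k$. Since the cells of dimension $\le k$ of $A\otimes A'$ depend only on the cells of dimension $\le k$ of $A$ and $A'$, $k$-collections inherit a truncated monoidal structure; a $k$-operad is a monoid for it. A $k$-contraction is contraction data restricted to parallel pairs of $m$-cells with $0\le m\le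 k-1$ (so contraction cells have dimension at most $k$). $\mathbf{Opd}_k$ is the category of (full, not truncated) collections whose underlying $k$-collection is equipped with the structure of a $k$-operad. $\mathbf{OWC}_{i,j}$ ($i,j\ge0$) is the category of (full) collections whose underlying $i$-collection is equipped with an $i$-contraction and whose underlying $j$-collection is equipped with the structure of a $j$-operad, with no compatibility axioms between the two. In each case morphisms are morphisms of collections preserving all the structure present. $M_{k+1}:\mathbf{Opd}_k\to\mathbf{Opd}_{k+1}$ is the left adjoint of $N_{k+1}$, chosen so that it leaves all dimensions of the underlying collection unchanged except dimension $k+1$ and preserves the underlying $k$-operad structure. *)

(* Defs.v *)
From mathcomp Require Import all_boot.
From Stdlib Require Import FunctionalExtensionality ProofIrrelevance.

Set Implicit Arguments.
Unset Strict Implicit.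
Unset Printing Implicit Defensive.

#[local] Obligation Tactic := intros; simpl.

Record gset := Gset {
  cell :> nat -> Type;
  src : forall n, cell n.+1 -> cell n;
  tgt : forall n, cell n.+1 -> cell n;
  src_src : forall n (x : cell n.+2), src (src x) = src (tgt x);
  tgt_src : forall n (x : cell n.+2), tgt (src x) = tgt (tgt x) }.

Record gmap (A B : gset) := Gmap {
  gfun :> forall n, A n -> B n;
  gmap_src : forall n (x : A n.+1), gfun (src x) = src (gfun x);
  gmap_tgt : forall n (x : A n.+1), gfun (tgt x) = tgt (gfun x) }.
Arguments gfun {A B} _ {n} _.

Lemma gmapP (A B : gset) (f g : gmap A B) :
  (forall n (x : A n), f n x = g n x) -> f = g.
Proof.
case: f g => f fs ft [g gs gt] /= e.
have ? : f = g.
  by apply: functional_extensionality_dep => n; apply: functional_extensionality.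
by subst g; rewrite (proof_irrelevance _ fs gs) (proof_irrelevance _ ft gt).
Qed.

Definition gid (A : gset) : gmap A A :=
  @Gmap A A (fun _ x => x) (fun _ _ => erefl) (fun _ _ => erefl).

Program Definition gcomp (A B C : gset) (g : gmap B C) (f : gmap A B) : gmap A C :=
  @Gmap A C (fun n x => g n (f n x)) _ _.
Next Obligation. by rewrite !gmap_src. Qed.
Next Obligation. by rewrite !gmap_tgt. Qed.

Definition gone : gset :=
  @Gset (fun _ => unit) (fun _ x => x) (fun _ x => x)
        (fun _ _ => erefl) (fun _ _ => erefl).

Definition gbang (A : gset) : gmap A gone :=
  @Gmap A gone (fun _ _ => tt) (fun _ _ => erefl) (fun _ _ => erefl).

Definition parallel (A : gset) (n : nat) : A n -> A n -> Prop :=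
  match n with
  | 0 => fun _ _ => True
  | _.+1 => fun a b => src a = src b /\ tgt a = tgt b
  end.

(* [iter_src z x] : z is the p-dimensional iterated source of the n-cell x
   (p <= n).  A relation, rather than a function, avoids casts between the
   types [A (n - p)]. *)
Inductive iter_src (A : gset) (p : nat) (z : A p) : forall n, A n -> Prop :=
| iter_src0 : iter_src z z
| iter_srcS n (x : A n.+1) : iter_src z (src x) -> iter_src z x.

Inductive iter_tgt (A : gset) (p : nat) (z : A p) : forall n, A n -> Prop :=
| iter_tgt0 : iter_tgt z z
| iter_tgtS n (x : A n.+1) : iter_tgt z (tgt x) -> iter_tgt z x.

Definition composable (A : gset) (n p : nat) (y x : A n) : Prop :=
  exists z : A p, iter_src z y /\ iter_tgt z x.
Arguments composable {A n} p y x.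

Inductive iter_idc (A : gset) (idc : forall n, A n -> A n.+1) (p : nat) (z : A p) :
  forall n, A n -> Prop :=
| iter_idc0 : iter_idc idc z z
| iter_idcS n (x : A n) : iter_idc idc z x -> iter_idc idc z (idc n x).

(* [comp lt y x h] is the composite of n-cells along a p-cell, first x then y.
   In each law, the composability proofs that are not given by the left-hand
   side follow from those that are, so quantifying over all of them is
   harmless. *)
Record strict_cat := StrictCat {
  sgset :> gset;
  idc : forall n, sgset n -> sgset n.+1;
  comp : forall n p, p < n ->
    forall y x : sgset n, composable p y x -> sgset n;
  src_idc : forall n (x : sgset n), src (idc x) = x;
  tgt_idc : forall n (x : sgset n), tgt (idc x) = x;
  src_comp_top : forall n (lt : n < n.+1) (y x : sgset n.+1) h,
    src (comp lt (y := y) (x := x) h) = src x;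
  tgt_comp_top : forall n (lt : n < n.+1) (y x : sgset n.+1) h,
    tgt (comp lt (y := y) (x := x) h) = tgt y;
  src_comp_low : forall n p (lt : p < n) (lt' : p < n.+1) (y x : sgset n.+1) h h',
    src (comp lt' (y := y) (x := x) h) = comp lt (y := src y) (x := src x) h';
  tgt_comp_low : forall n p (lt : p < n) (lt' : p < n.+1) (y x : sgset n.+1) h h',
    tgt (comp lt' (y := y) (x := x) h) = comp lt (y := tgt y) (x := tgt x) h';
  compA : forall n p (lt : p < n) (z y x : sgset n) h1 h2 h3 h4,
    comp lt (y := z) (x := comp lt (y := y) (x := x) h1) h2 =
    comp lt (y := comp lt (y := z) (x := y) h3) (x := x) h4;
  comp_idl : forall n p (lt : p < n) (x : sgset n) (z : sgset p) (i : sgset n) h,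
    iter_tgt z x -> iter_idc idc z i -> comp lt (y := i) (x := x) h = x;
  comp_idr : forall n p (lt : p < n) (x : sgset n) (z : sgset p) (i : sgset n) h,
    iter_src z x -> iter_idc idc z i -> comp lt (y := x) (x := i) h = x;
  interchange : forall n p q (ltp : p < n) (ltq : q < n), q < p ->
    forall (y' y x' x : sgset n) h1 h2 h3 h4 h5 h6,
    comp ltq (y := comp ltp (y := y') (x := y) h1)
             (x := comp ltp (y := x') (x := x) h2) h3 =
    comp ltp (y := comp ltq (y := y') (x := x') h4)
             (x := comp ltq (y := y) (x := x) h5) h6;
  comp_idc : forall n p (lt : p < n) (lt' : p < n.+1) (y x : sgset n) h h',
    comp lt' (y := idc y) (x := idc x) h' = idc (comp lt (y := y) (x := x) h) }.
Arguments idc {s n} _.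
Arguments comp {s n p} _ y x _.

Definition is_sfunctor (C D : strict_cat) (f : gmap C D) : Prop :=
  (forall n (x : C n), f n.+1 (idc x) = idc (f n x)) /\
  (forall n p (lt : p < n) (y x : C n) h h',
     f n (comp lt y x h) = comp lt (f n y) (f n x) h').

Lemma gmap_composable (A B : gset) (f : gmap A B) n p (y x : A n) :
  composable p y x -> composable p (f n y) (f n x).
Proof.
case=> z [hy hx]; exists (f p z); split.
- elim: hy => [|m w _ ih]; first exact: iter_src0.
  by apply: iter_srcS; rewrite -gmap_src.
- elim: hx => [|m w _ ih]; first exact: iter_tgt0.
  by apply: iter_tgtS; rewrite -gmap_tgt.
Qed.

Lemma is_sfunctor_id (C : strict_cat) : is_sfunctor (gid C).
Proof.
split=> // n p lt y x h h' /=.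
by rewrite (proof_irrelevance _ h h').
Qed.

Lemma is_sfunctor_comp (C D E : strict_cat) (g : gmap D E) (f : gmap C D) :
  is_sfunctor g -> is_sfunctor f -> is_sfunctor (gcomp g f).
Proof.
move=> [gi gc] [fi fc]; split=> [n x | n p lt y x h h'] /=.
  by rewrite fi gi.
by rewrite (fc _ _ _ _ _ h (gmap_composable f h)) gc.
Qed.

(* A left adjoint to the forgetful functor from strict omega-categories to
   globular sets, given by universal arrows; it is unique up to unique
   isomorphism.  The functor T, the multiplication mu and the monad laws are
   derived below. *)
Record free_monad := FreeMonad {
  free : gset -> strict_cat;
  eta : forall A, gmap A (free A);
  ext : forall (A : gset) (C : strict_cat), gmap A C -> gmap (free A) C;
  ext_sfunctor : forall A (C : strict_cat) (f : gmap A C), is_sfunctor (ext f);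
  ext_eta : forall A (C : strict_cat) (f : gmap A C), gcomp (ext f) (eta A) = f;
  ext_uniq : forall A (C : strict_cat) (f : gmap A C) (g : gmap (free A) C),
    is_sfunctor g -> gcomp g (eta A) = f -> g = ext f }.
Arguments ext _ {A C} _.

Section Collections.
Context (T : free_monad).

Definition Tob (A : gset) : gset := free T A.

Definition Tmap (A B : gset) (f : gmap A B) : gmap (Tob A) (Tob B) :=
  ext T (gcomp (eta T B) f).

Definition mu (A : gset) : gmap (Tob (Tob A)) (Tob A) := ext T (gid (free T A)).

Lemma TmapE (A B : gset) (f : gmap A B) n (x : A n) :
  Tmap f n (eta T A n x) = eta T B n (f n x).
Proof.
have e := @ext_eta T A (free T B) (gcomp (eta T B) f).
exact: (f_equal (fun h : gmap A (free T B) => h n x) e).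
Qed.

Lemma mu_eta (A : gset) n (x : Tob A n) : mu A n (eta T (Tob A) n x) = x.
Proof.
have e := @ext_eta T (Tob A) (free T A) (gid (free T A)).
exact: (f_equal (fun h : gmap (Tob A) (free T A) => h n x) e).
Qed.

Lemma free_ext (A : gset) (C : strict_cat) (f g : gmap (free T A) C) :
  is_sfunctor f -> is_sfunctor g ->
  (forall n (x : A n), f n (eta T A n x) = g n (eta T A n x)) -> f = g.
Proof.
move=> hf hg e; rewrite (ext_uniq hf erefl); apply/esym/ext_uniq => //.
by apply: gmapP => n x /=; rewrite e.
Qed.

Lemma Tmap_id (A : gset) : Tmap (gid A) = gid (Tob A).
Proof.
apply: free_ext; [exact: ext_sfunctor | exact: is_sfunctor_id | ].
by move=> n x; rewrite TmapE.
Qed.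

Lemma Tmap_comp (A B C : gset) (g : gmap B C) (f : gmap A B) n x :
  Tmap (gcomp g f) n x = Tmap g n (Tmap f n x).
Proof.
suff -> : Tmap (gcomp g f) = gcomp (Tmap g) (Tmap f) by [].
apply: free_ext; [exact: ext_sfunctor | | ].
  by apply: is_sfunctor_comp; exact: ext_sfunctor.
by move=> m y /=; rewrite !TmapE.
Qed.

Lemma Tmap_ext (A B : gset) (f g : gmap A B) n (x : Tob A n) :
  (forall m (y : A m), f m y = g m y) -> Tmap f n x = Tmap g n x.
Proof. by move=> /gmapP ->. Qed.

Lemma mu_nat (A B : gset) (f : gmap A B) n x :
  Tmap f n (mu A n x) = mu B n (Tmap (Tmap f) n x).
Proof.
suff e : gcomp (Tmap f) (mu A) = gcomp (mu B) (Tmap (Tmap f)).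
  exact: (f_equal (fun h : gmap (Tob (Tob A)) (Tob B) => h n x) e).
apply: free_ext; try by apply: is_sfunctor_comp; exact: ext_sfunctor.
by move=> m y /=; rewrite TmapE !mu_eta.
Qed.

Lemma mu_mu (A : gset) n x :
  mu A n (Tmap (mu A) n x) = mu A n (mu (Tob A) n x).
Proof.
suff e : gcomp (mu A) (Tmap (mu A)) = gcomp (mu A) (mu (Tob A)).
  exact: (f_equal (fun h : gmap (Tob (Tob (Tob A))) (Tob A) => h n x) e).
apply: free_ext; try by apply: is_sfunctor_comp; exact: ext_sfunctor.
by move=> m y /=; rewrite TmapE !mu_eta.
Qed.

Lemma mu_Teta (A : gset) n (x : Tob A n) : mu A n (Tmap (eta T A) n x) = x.
Proof.
suff e : gcomp (mu A) (Tmap (eta T A)) = gid (Tob A).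
  exact: (f_equal (fun h : gmap (Tob A) (Tob A) => h n x) e).
apply: free_ext; [ | exact: is_sfunctor_id | ].
  by apply: is_sfunctor_comp; exact: ext_sfunctor.
by move=> m y /=; rewrite TmapE mu_eta.
Qed.

Record coll := Coll {
  cgset :> gset;
  arity : gmap cgset (Tob gone) }.
Arguments arity : clear implicits.

Record coll_hom (X Y : coll) := CollHom {
  cmap :> gmap X Y;
  cmap_arity : forall n (x : X n), arity Y n (cmap n x) = arity X n x }.

Lemma coll_homP (X Y : coll) (f g : coll_hom X Y) :
  (forall n (x : X n), f n x = g n x) -> f = g.
Proof.
case: f g => f fa [g ga] /= /gmapP e; subst g.
by rewrite (proof_irrelevance _ fa ga).
Qed.

Definition cid (X : coll) : coll_hom X X := @CollHom X X (gid X) (fun _ _ => erefl).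

Program Definition ccomp (X Y Z : coll) (g : coll_hom Y Z) (f : coll_hom X Y) :
  coll_hom X Z := @CollHom X Z (gcomp g f) _.
Next Obligation. by rewrite !cmap_arity. Qed.

Lemma ccompA (X Y Z W : coll) (h : coll_hom Z W) (g : coll_hom Y Z)
  (f : coll_hom X Y) : ccomp h (ccomp g f) = ccomp (ccomp h g) f.
Proof. exact: coll_homP. Qed.

Definition cunit : coll := @Coll gone (eta T gone).

Record tcell (X Y : coll) (n : nat) := Tcell {
  tfst : X n;
  tsnd : Tob Y n;
  tcellP : arity X n tfst = Tmap (gbang Y) n tsnd }.

Lemma tcell_eq (X Y : coll) n (u v : tcell X Y n) :
  tfst u = tfst v -> tsnd u = tsnd v -> u = v.
Proof.
case: u v => a x e [b y e'] /= ? ?; subst b y.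
by rewrite (proof_irrelevance _ e e').
Qed.

Program Definition tgset (X Y : coll) : gset :=
  @Gset (tcell X Y)
    (fun n u => @Tcell X Y n (src (tfst u)) (src (tsnd u)) _)
    (fun n u => @Tcell X Y n (tgt (tfst u)) (tgt (tsnd u)) _) _ _.
Next Obligation. by rewrite !gmap_src tcellP. Qed.
Next Obligation. by rewrite !gmap_tgt tcellP. Qed.
Next Obligation. by apply: tcell_eq; rewrite /= src_src. Qed.
Next Obligation. by apply: tcell_eq; rewrite /= tgt_src. Qed.

Definition tpr1 (X Y : coll) : gmap (tgset X Y) X :=
  @Gmap (tgset X Y) X (fun n u => tfst u) (fun _ _ => erefl) (fun _ _ => erefl).

Definition tpr2 (X Y : coll) : gmap (tgset X Y) (Tob Y) :=
  @Gmap (tgset X Y) (Tob Y) (fun n u => tsnd u) (fun _ _ => erefl) (fun _ _ => erefl).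

Definition tensor (X Y : coll) : coll :=
  @Coll (tgset X Y) (gcomp (mu gone) (gcomp (Tmap (arity Y)) (tpr2 X Y))).

Lemma Tbang (A B : gset) (f : gmap A B) n (x : Tob A n) :
  Tmap (gbang B) n (Tmap f n x) = Tmap (gbang A) n x.
Proof. by rewrite -Tmap_comp; congr (Tmap _ n x); apply: gmapP. Qed.

Program Definition tensor_map (X X' Y Y' : coll) (f : coll_hom X X')
    (g : coll_hom Y Y') : coll_hom (tensor X Y) (tensor X' Y') :=
  @CollHom (tensor X Y) (tensor X' Y')
    (@Gmap (tgset X Y) (tgset X' Y')
       (fun n u => @Tcell X' Y' n (f n (tfst u)) (Tmap g n (tsnd u)) _) _ _) _.
Next Obligation. by rewrite cmap_arity Tbang tcellP. Qed.
Next Obligation. by apply: tcell_eq; rewrite /= gmap_src. Qed.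
Next Obligation. by apply: tcell_eq; rewrite /= gmap_tgt. Qed.
Next Obligation.
rewrite -Tmap_comp; congr (mu _ _ (Tmap _ _ _)).
by apply: gmapP => m y /=; rewrite cmap_arity.
Qed.

(* The constraints of the tensor product of collections, each in the direction
   in which it is given by a formula; the inverses exist because T is a
   cartesian monad.  [tlam_inv] is a |-> ( * , eta a), [trho] is
   (a, x) |-> a, and [tassoc_inv] is (a, z) |-> ((a, T pr1 z), mu (T pr2 z)). *)

Program Definition tlam_inv (X : coll) : coll_hom X (tensor cunit X) :=
  @CollHom X (tensor cunit X)
    (@Gmap X (tgset cunit X) (fun n a => @Tcell cunit X n tt (eta T X n a) _) _ _) _.
Next Obligation. by rewrite TmapE. Qed.
Next Obligation. by apply: tcell_eq; rewrite /= ?gmap_src. Qed.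
Next Obligation. by apply: tcell_eq; rewrite /= ?gmap_tgt. Qed.
Next Obligation. by rewrite TmapE mu_eta. Qed.

Program Definition trho (X : coll) : coll_hom (tensor X cunit) X :=
  @CollHom (tensor X cunit) X (tpr1 X cunit) _.
Next Obligation.
rewrite tcellP /= mu_Teta.
have -> : gbang gone = gid gone by apply: gmapP => m [].
by rewrite Tmap_id.
Qed.

Lemma tassoc_subproof1 (X Y Z : coll) n (u : tensor X (tensor Y Z) n) :
  arity X n (tfst u) = Tmap (gbang Y) n (Tmap (tpr1 Y Z) n (tsnd u)).
Proof. by rewrite Tbang tcellP. Qed.

Lemma tassoc_subproof2 (X Y Z : coll) n (u : tensor X (tensor Y Z) n) :
  arity (tensor X Y) n (Tcell (tassoc_subproof1 u)) =
  Tmap (gbang Z) n (mu Z n (Tmap (tpr2 Y Z) n (tsnd u))).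
Proof.
rewrite /= mu_nat -!Tmap_comp; congr (mu _ _ (Tmap _ _ _)).
by apply: gmapP => m v /=; rewrite tcellP.
Qed.

Program Definition tassoc_inv (X Y Z : coll) :
    coll_hom (tensor X (tensor Y Z)) (tensor (tensor X Y) Z) :=
  @CollHom (tensor X (tensor Y Z)) (tensor (tensor X Y) Z)
    (@Gmap (tensor X (tensor Y Z)) (tensor (tensor X Y) Z)
       (fun n u => @Tcell (tensor X Y) Z n _ _ (tassoc_subproof2 u)) _ _) _.
Next Obligation.
by apply: tcell_eq; [apply: tcell_eq|]; rewrite //= !gmap_src.
Qed.
Next Obligation.
by apply: tcell_eq; [apply: tcell_eq|]; rewrite //= !gmap_tgt.
Qed.
Next Obligation.
by rewrite mu_nat !(Tmap_comp (mu gone)) mu_mu -!Tmap_comp.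
Qed.

Lemma bounded_eq (A : Type) (b : bool) (x y : {_ : A | b}) : sval x = sval y -> x = y.
Proof.
case: x y => x hx [y hy] /= e; subst y.
by rewrite (proof_irrelevance _ hx hy).
Qed.

Program Definition trunc_gset (k : nat) (A : gset) : gset :=
  @Gset (fun n => {a : A n | n <= k})
    (fun n x => exist _ (src (sval x)) (ltnW (svalP x)))
    (fun n x => exist _ (tgt (sval x)) (ltnW (svalP x))) _ _.
Next Obligation. by apply: bounded_eq; rewrite /= src_src. Qed.
Next Obligation. by apply: bounded_eq; rewrite /= tgt_src. Qed.

Definition trunc_incl (k : nat) (A : gset) : gmap (trunc_gset k A) A :=
  @Gmap (trunc_gset k A) A (fun n x => sval x) (fun _ _ => erefl) (fun _ _ => erefl).

(* The category of k-globular sets is identified with that of globular sets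
   having no cell of dimension > k. *)
Record kcoll (k : nat) := Kcoll {
  kc :> coll;
  kc_dim : forall n, kc n -> n <= k }.

Definition ktrunc (k : nat) (X : coll) : kcoll k :=
  @Kcoll k (@Coll (trunc_gset k X) (gcomp (arity X) (trunc_incl k X)))
    (fun n x => svalP x).

Definition kincl (k : nat) (X : coll) : coll_hom (ktrunc k X) X :=
  @CollHom (ktrunc k X) X (trunc_incl k X) (fun _ _ => erefl).

Program Definition klift (k : nat) (P : kcoll k) (X : coll) (f : coll_hom P X) :
    coll_hom P (ktrunc k X) :=
  @CollHom P (ktrunc k X)
    (@Gmap P (ktrunc k X) (fun n x => exist _ (f n x) (kc_dim x)) _ _) _.
Next Obligation. by apply: bounded_eq; rewrite /= gmap_src. Qed.
Next Obligation. by apply: bounded_eq; rewrite /= gmap_tgt. Qed.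
Next Obligation. by rewrite cmap_arity. Qed.

Definition ktrunc_map (k : nat) (X Y : coll) (f : coll_hom X Y) :
    coll_hom (ktrunc k X) (ktrunc k Y) :=
  klift (ccomp f (kincl k X)).

Lemma klift_fst_subproof (k : nat) (P : kcoll k) (X Y : coll)
    (f : coll_hom P (tensor X Y)) n (a : P n) :
  arity (ktrunc k X) n (exist _ (tfst (f n a)) (kc_dim a)) =
  Tmap (gbang Y) n (tsnd (f n a)).
Proof. by rewrite /= tcellP. Qed.

Program Definition klift_fst (k : nat) (P : kcoll k) (X Y : coll)
    (f : coll_hom P (tensor X Y)) : coll_hom P (tensor (ktrunc k X) Y) :=
  @CollHom P (tensor (ktrunc k X) Y)
    (@Gmap P (tensor (ktrunc k X) Y)
       (fun n a => Tcell (klift_fst_subproof f a)) _ _) _.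
Next Obligation.
by apply: tcell_eq; [apply: bounded_eq|]; rewrite /= gmap_src.
Qed.
Next Obligation.
by apply: tcell_eq; [apply: bounded_eq|]; rewrite /= gmap_tgt.
Qed.
Next Obligation. exact: cmap_arity f n x. Qed.

Section Truncated.
Context (k : nat).

(* In dimensions <= k the tensor product does not depend on the cells of
   dimension > k of its factors, so it may be computed on the extension of
   k-collections that has no such cells, and then truncated. *)
Definition ktensor (P Q : kcoll k) : kcoll k := ktrunc k (tensor P Q).

Definition ktensor_map (P P' Q Q' : kcoll k) (f : coll_hom P P')
    (g : coll_hom Q Q') : coll_hom (ktensor P Q) (ktensor P' Q') :=
  ktrunc_map k (tensor_map f g).

Lemma ktensor_map_comp (P P' P'' Q Q' Q'' : kcoll k)
    (f' : coll_hom P' P'') (f : coll_hom P P')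
    (g' : coll_hom Q' Q'') (g : coll_hom Q Q') :
  ktensor_map (ccomp f' f) (ccomp g' g) = ccomp (ktensor_map f' g') (ktensor_map f g).
Proof.
apply: coll_homP => n x; apply: bounded_eq; apply: tcell_eq => //=.
by rewrite -Tmap_comp.
Qed.

Definition kunit : kcoll k := ktrunc k cunit.

Definition klam_inv (P : kcoll k) : coll_hom P (ktensor kunit P) :=
  klift (klift_fst (tlam_inv P)).

Definition krho (P : kcoll k) : coll_hom (ktensor P kunit) P :=
  ccomp (trho P)
    (ccomp (tensor_map (cid P) (kincl k cunit)) (kincl k (tensor P kunit))).

Definition kassoc_inv (P Q R : kcoll k) :
    coll_hom (ktensor P (ktensor Q R)) (ktensor (ktensor P Q) R) :=
  klift (klift_fst
    (ccomp (tassoc_inv P Q R)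
      (ccomp (tensor_map (cid P) (kincl k (tensor Q R)))
             (kincl k (tensor P (ktensor Q R)))))).

Record kmonoid (P : kcoll k) := Kmonoid {
  kmul : coll_hom (ktensor P P) P;
  kone : coll_hom kunit P;
  kmulA : ccomp kmul (ccomp (ktensor_map kmul (cid P)) (kassoc_inv P P P)) =
          ccomp kmul (ktensor_map (cid P) kmul);
  kmul1l : ccomp kmul (ccomp (ktensor_map kone (cid P)) (klam_inv P)) = cid P;
  kmul1r : ccomp kmul (ktensor_map (cid P) kone) = krho P }.

Definition is_kmonoid_hom (P Q : kcoll k) (mP : kmonoid P) (mQ : kmonoid Q)
    (f : coll_hom P Q) : Prop :=
  ccomp f (kmul mP) = ccomp (kmul mQ) (ktensor_map f f) /\
  ccomp f (kone mP) = kone mQ.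

Record opd_obj := OpdObj {
  ocoll :> coll;
  omon : kmonoid (ktrunc k ocoll) }.

Record opd_hom (X Y : opd_obj) := OpdHom {
  omap :> coll_hom X Y;
  omap_mon : is_kmonoid_hom (omon X) (omon Y) (ktrunc_map k omap) }.

Lemma opd_homP (X Y : opd_obj) (f g : opd_hom X Y) :
  (forall n (x : X n), f n x = g n x) -> f = g.
Proof.
case: f g => f hf [g hg] /= /coll_homP e; subst g.
by rewrite (proof_irrelevance _ hf hg).
Qed.

Program Definition opd_id (X : opd_obj) : opd_hom X X := @OpdHom X X (cid X) _.
Next Obligation.
have -> : ktrunc_map k (cid X) = cid (ktrunc k X).
  by apply: coll_homP => n x; apply: bounded_eq.
split; apply: coll_homP => n x //=.
by congr (kmul (omon X) n _); apply: bounded_eq; apply: tcell_eq; rewrite //= Tmap_id.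
Qed.

Program Definition opd_comp (X Y Z : opd_obj) (g : opd_hom Y Z) (f : opd_hom X Y) :
  opd_hom X Z := @OpdHom X Z (ccomp g f) _.
Next Obligation.
have e : ktrunc_map k (ccomp g f) = ccomp (ktrunc_map k g) (ktrunc_map k f).
  by apply: coll_homP => n x; apply: bounded_eq.
case: (omap_mon f) (omap_mon g) => fm fo [gm go].
rewrite /is_kmonoid_hom e ktensor_map_comp.
by rewrite ccompA -gm -!ccompA -fm fo go.
Qed.

End Truncated.

Section Restriction.
Context (k : nat).

Definition kwiden (P : kcoll k) : kcoll k.+1 :=
  @Kcoll k.+1 P (fun n x => leqW (kc_dim x)).

Definition kstep (X : coll) : coll_hom (ktrunc k X) (ktrunc k.+1 X) :=
  klift (P := kwiden (ktrunc k X)) (kincl k X).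

Lemma kstep_inj (P X : coll) (f g : coll_hom P (ktrunc k X)) :
  ccomp (kstep X) f = ccomp (kstep X) g -> f = g.
Proof.
move=> e; apply: coll_homP => n x; apply: bounded_eq.
exact: (f_equal (fun h : coll_hom P (ktrunc k.+1 X) => sval (h n x)) e).
Qed.

Definition ktensor_step (P Q : kcoll k) (P' Q' : kcoll k.+1)
    (f : coll_hom P P') (g : coll_hom Q Q') :
    coll_hom (ktensor P Q) (ktensor P' Q') :=
  klift (P := kwiden (ktensor P Q)) (ccomp (tensor_map f g) (kincl k (tensor P Q))).

Lemma ktensor_step_mapl (P Q P0 Q0 : kcoll k) (P' Q' : kcoll k.+1)
    (f : coll_hom P P') (g : coll_hom Q Q') (a : coll_hom P0 P) (b : coll_hom Q0 Q) :
  ccomp (ktensor_step f g) (ktensor_map a b) = ktensor_step (ccomp f a) (ccomp g b).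
Proof.
apply: coll_homP => n x; apply: bounded_eq; apply: tcell_eq => //=.
by rewrite -Tmap_comp.
Qed.

Lemma ktensor_step_mapr (P Q : kcoll k) (P' Q' P0 Q0 : kcoll k.+1)
    (f : coll_hom P P') (g : coll_hom Q Q') (a : coll_hom P' P0) (b : coll_hom Q' Q0) :
  ccomp (ktensor_map a b) (ktensor_step f g) = ktensor_step (ccomp a f) (ccomp b g).
Proof.
apply: coll_homP => n x; apply: bounded_eq; apply: tcell_eq => //=.
by rewrite -Tmap_comp.
Qed.

Lemma ktensor_step_assoc (P Q R : kcoll k) (P' Q' R' : kcoll k.+1)
    (f : coll_hom P P') (g : coll_hom Q Q') (h : coll_hom R R') :
  ccomp (ktensor_step (ktensor_step f g) h) (kassoc_inv P Q R) =
  ccomp (kassoc_inv P' Q' R') (ktensor_step f (ktensor_step g h)).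
Proof.
apply: coll_homP => n x; apply: bounded_eq; apply: tcell_eq => /=.
  apply: bounded_eq; apply: tcell_eq => //=.
  by rewrite -!Tmap_comp; apply: Tmap_ext.
by rewrite mu_nat -!Tmap_comp; congr (mu _ _ _); apply: Tmap_ext.
Qed.

Lemma ktensor_step_lam (P : kcoll k) (P' : kcoll k.+1) (f : coll_hom P P') :
  ccomp (ktensor_step (kstep cunit) f) (klam_inv P) = ccomp (klam_inv P') f.
Proof.
apply: coll_homP => n x; apply: bounded_eq; apply: tcell_eq => /=.
  exact: bounded_eq.
by rewrite TmapE.
Qed.

Lemma ktensor_step_rho (P : kcoll k) (P' : kcoll k.+1) (f : coll_hom P P') :
  ccomp (krho P') (ktensor_step f (kstep cunit)) = ccomp f (krho P).
Proof. exact: coll_homP. Qed.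

Definition kmul_restr (X : coll) (m : kmonoid (ktrunc k.+1 X)) :
    coll_hom (ktensor (ktrunc k X) (ktrunc k X)) (ktrunc k X) :=
  klift (ccomp (kincl k.+1 X) (ccomp (kmul m) (ktensor_step (kstep X) (kstep X)))).

Definition kone_restr (X : coll) (m : kmonoid (ktrunc k.+1 X)) :
    coll_hom (kunit k) (ktrunc k X) :=
  klift (ccomp (kincl k.+1 X) (ccomp (kone m) (kstep cunit))).

Lemma kstep_mul (X : coll) (m : kmonoid (ktrunc k.+1 X)) :
  ccomp (kstep X) (kmul_restr m) =
  ccomp (kmul m) (ktensor_step (kstep X) (kstep X)).
Proof. by apply: coll_homP => n x; apply: bounded_eq. Qed.

Lemma kstep_one (X : coll) (m : kmonoid (ktrunc k.+1 X)) :
  ccomp (kstep X) (kone_restr m) = ccomp (kone m) (kstep cunit).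
Proof. by apply: coll_homP => n x; apply: bounded_eq. Qed.

Lemma kstep_nat (X Y : coll) (f : coll_hom X Y) :
  ccomp (kstep Y) (ktrunc_map k f) = ccomp (ktrunc_map k.+1 f) (kstep X).
Proof. by apply: coll_homP => n x; apply: bounded_eq. Qed.

Lemma ccomp1f (X Y : coll) (f : coll_hom X Y) : ccomp (cid Y) f = f.
Proof. exact: coll_homP. Qed.

Lemma ccompf1 (X Y : coll) (f : coll_hom X Y) : ccomp f (cid X) = f.
Proof. exact: coll_homP. Qed.

#[local] Obligation Tactic := intros.

Program Definition kmonoid_restr (X : coll) (m : kmonoid (ktrunc k.+1 X)) :
    kmonoid (ktrunc k X) :=
  @Kmonoid k (ktrunc k X) (kmul_restr m) (kone_restr m) _ _ _.
Next Obligation.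
apply: kstep_inj; rewrite !ccompA !kstep_mul -!ccompA ktensor_step_mapl.
rewrite (ccompA (ktensor_step _ _)) ktensor_step_mapl kstep_mul !ccompf1.
set s := kstep X; set S := ktensor_step s s.
have -> : ktensor_step (ccomp (kmul m) S) s =
    ccomp (ktensor_map (kmul m) (cid _)) (ktensor_step S s).
  by rewrite ktensor_step_mapr ccomp1f.
have -> : ktensor_step s (ccomp (kmul m) S) =
    ccomp (ktensor_map (cid _) (kmul m)) (ktensor_step s S).
  by rewrite ktensor_step_mapr ccomp1f.
by rewrite -!ccompA ktensor_step_assoc !ccompA -kmulA !ccompA.
Qed.
Next Obligation.
apply: kstep_inj; rewrite !ccompA kstep_mul -!ccompA.
rewrite (ccompA (ktensor_step _ _)) ktensor_step_mapl kstep_one !ccompf1.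
set s := kstep X; set s0 := kstep cunit.
have -> : ktensor_step (ccomp (kone m) s0) s =
    ccomp (ktensor_map (kone m) (cid _)) (ktensor_step s0 s).
  by rewrite ktensor_step_mapr ccomp1f.
rewrite -ccompA ktensor_step_lam (ccompA (ktensor_map _ _)) ccompA kmul1l.
by rewrite ccomp1f.
Qed.
Next Obligation.
apply: kstep_inj; rewrite !ccompA kstep_mul -!ccompA.
rewrite ktensor_step_mapl kstep_one !ccompf1.
set s := kstep X; set s0 := kstep cunit.
have -> : ktensor_step s (ccomp (kone m) s0) =
    ccomp (ktensor_map (cid _) (kone m)) (ktensor_step s s0).
  by rewrite ktensor_step_mapr ccomp1f.
by rewrite (ccompA (kmul m)) kmul1r ktensor_step_rho.
Qed.

Definition opd_restr (X : opd_obj k.+1) : opd_obj k :=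
  @OpdObj k X (kmonoid_restr (omon X)).

Program Definition opd_restr_map (X Y : opd_obj k.+1) (f : opd_hom X Y) :
  opd_hom (opd_restr X) (opd_restr Y) := @OpdHom k (opd_restr X) (opd_restr Y) f _.
Next Obligation.
case: (omap_mon f) => fm fo; split; apply: kstep_inj; rewrite !ccompA.
  rewrite kstep_nat kstep_mul -!ccompA kstep_mul ktensor_step_mapl kstep_nat.
  by rewrite -ktensor_step_mapr !ccompA fm.
by rewrite kstep_nat -ccompA kstep_one ccompA fo kstep_one.
Qed.

End Restriction.
(* The part of a contraction on X whose contraction cells have dimension <= i. *)
Record contraction (i : nat) (X : coll) := Contraction {
  ctr : forall m, m < i -> forall a b : X m, parallel a b ->
    forall th : Tob gone m.+1,
    src th = arity X m a -> tgt th = arity X m b -> X m.+1;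
  ctr_src : forall m (lt : m < i) (a b : X m) (par : parallel a b) th hs ht,
    src (ctr lt par (th := th) hs ht) = a;
  ctr_tgt : forall m (lt : m < i) (a b : X m) (par : parallel a b) th hs ht,
    tgt (ctr lt par (th := th) hs ht) = b;
  ctr_arity : forall m (lt : m < i) (a b : X m) (par : parallel a b) th hs ht,
    arity X m.+1 (ctr lt par (th := th) hs ht) = th }.

(* The conditions on [f a], [f b] and [th] needed to form the right-hand side
   follow from those on [a], [b] and [th], since f is a morphism of collections. *)
Definition preserves_ctr (i : nat) (X Y : coll) (cX : contraction i X)
    (cY : contraction i Y) (f : coll_hom X Y) : Prop :=
  forall m (lt : m < i) (a b : X m) (par : parallel a b) th hs ht par' hs' ht',
    f m.+1 (ctr cX lt par (th := th) hs ht) =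
    ctr cY lt (a := f m a) (b := f m b) par' (th := th) hs' ht'.

Record owc_obj (i j : nat) := OwcObj {
  owc_opd :> opd_obj j;
  owc_ctr : contraction i owc_opd }.

Record owc_hom (i j : nat) (X Y : owc_obj i j) := OwcHom {
  owc_map :> opd_hom X Y;
  owc_map_ctr : preserves_ctr (owc_ctr X) (owc_ctr Y) owc_map }.

Lemma owc_homP (i j : nat) (X Y : owc_obj i j) (f g : owc_hom X Y) :
  owc_map f = owc_map g -> f = g.
Proof.
case: f g => f hf [g hg] /= e; subst g.
by rewrite (proof_irrelevance _ hf hg).
Qed.

Lemma gmap_parallel (A B : gset) (f : gmap A B) n (a b : A n) :
  parallel a b -> parallel (f n a) (f n b).
Proof. by case: n a b => //= n a b [hs ht]; rewrite -!gmap_src -!gmap_tgt hs ht. Qed.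

Program Definition owc_id (i j : nat) (X : owc_obj i j) : owc_hom X X :=
  @OwcHom i j X X (opd_id X) _.
Next Obligation.
move=> m lt a b par th hs ht par' hs' ht' /=.
by rewrite (proof_irrelevance _ par par') (proof_irrelevance _ hs hs')
           (proof_irrelevance _ ht ht').
Qed.

Program Definition owc_comp (i j : nat) (X Y Z : owc_obj i j) (g : owc_hom Y Z)
  (f : owc_hom X Y) : owc_hom X Z := @OwcHom i j X Z (opd_comp g f) _.
Next Obligation.
move=> m lt a b par th hs ht par' hs' ht' /=.
have hs1 : src th = arity Y m (f m a) by rewrite cmap_arity.
have ht1 : tgt th = arity Y m (f m b) by rewrite cmap_arity.
rewrite (@owc_map_ctr _ _ _ _ f m lt a b par th hs ht (gmap_parallel f par) hs1 ht1).
exact: (@owc_map_ctr _ _ _ _ g).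
Qed.

End Collections.

Record category := Category {
  ob :> Type;
  hom : ob -> ob -> Type;
  idm : forall x, hom x x;
  cmp : forall x y z, hom y z -> hom x y -> hom x z;
  cmp1f : forall x y (f : hom x y), cmp (idm y) f = f;
  cmpf1 : forall x y (f : hom x y), cmp f (idm x) = f;
  cmpA : forall x y z w (h : hom z w) (g : hom y z) (f : hom x y),
    cmp h (cmp g f) = cmp (cmp h g) f }.
Arguments hom {c} _ _.
Arguments idm {c} x.
Arguments cmp {c x y z} _ _.

Record functor (C D : category) := Functor {
  fob :> C -> D;
  fmap : forall x y : C, hom x y -> hom (fob x) (fob y);
  fmap_id : forall x, fmap (idm x) = idm (fob x);
  fmap_cmp : forall x y z (g : hom y z) (f : hom x y),
    fmap (cmp g f) = cmp (fmap g) (fmap f) }.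
Arguments fmap {C D} _ {x y} _.

Program Definition functor_comp (C D E : category) (G : functor D E)
    (F : functor C D) : functor C E :=
  @Functor C E (fun x => G (F x)) (fun x y f => fmap G (fmap F f)) _ _.
Next Obligation. by rewrite !fmap_id. Qed.
Next Obligation. by rewrite !fmap_cmp. Qed.

(* [adjunction F G] : F is left adjoint to G. *)
Record adjunction (C D : category) (F : functor C D) (G : functor D C) := Adjunction {
  adj_unit : forall x : C, hom x (G (F x));
  adj_counit : forall y : D, hom (F (G y)) y;
  adj_unit_nat : forall (x x' : C) (f : hom x x'),
    cmp (fmap G (fmap F f)) (adj_unit x) = cmp (adj_unit x') f;
  adj_counit_nat : forall (y y' : D) (g : hom y y'),
    cmp g (adj_counit y) = cmp (adj_counit y') (fmap F (fmap G g));
  adj_triangle_l : forall x : C,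
    cmp (adj_counit (F x)) (fmap F (adj_unit x)) = idm (F x);
  adj_triangle_r : forall y : D,
    cmp (fmap G (adj_counit y)) (adj_unit (G y)) = idm (G y) }.

(* Equality of morphisms whose domains and codomains are only provably equal. *)
Inductive hom_eq (C : category) (x y : C) (f : hom x y) :
  forall x' y' : C, hom x' y' -> Prop :=
| hom_eq_refl : hom_eq f f.

Section Categories.
Context (T : free_monad).

Program Definition Opd (k : nat) : category :=
  @Category (opd_obj T k) (@opd_hom T k) (@opd_id T k) (@opd_comp T k) _ _ _.
Next Obligation. exact: opd_homP. Qed.
Next Obligation. exact: opd_homP. Qed.
Next Obligation. exact: opd_homP. Qed.

Program Definition OWC (i j : nat) : category :=
  @Category (owc_obj T i j) (@owc_hom T i j) (@owc_id T i j) (@owc_comp T i j) _ _ _.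
Next Obligation. by apply: owc_homP; apply: opd_homP. Qed.
Next Obligation. by apply: owc_homP; apply: opd_homP. Qed.
Next Obligation. by apply: owc_homP; apply: opd_homP. Qed.

(* N k is the functor N_{k+1}. *)
Program Definition N (k : nat) : functor (Opd k.+1) (Opd k) :=
  @Functor (Opd k.+1) (Opd k) (@opd_restr T k) (@opd_restr_map T k) _ _.
Next Obligation. exact: opd_homP. Qed.
Next Obligation. exact: opd_homP. Qed.

Definition owc_restr (i k : nat) (X : OWC i k.+1) : OWC i k :=
  @OwcObj T i k (opd_restr X) (owc_ctr X).

Definition owc_restr_map (i k : nat) (X Y : OWC i k.+1) (f : hom X Y) :
    hom (owc_restr X) (owc_restr Y) :=
  @OwcHom T i k (owc_restr X) (owc_restr Y) (opd_restr_map f)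
    (@owc_map_ctr T i k.+1 X Y f).

(* G i k is the functor G_{i,k+1}. *)
Program Definition G (i k : nat) : functor (OWC i k.+1) (OWC i k) :=
  @Functor (OWC i k.+1) (OWC i k) (@owc_restr i k) (@owc_restr_map i k) _ _.
Next Obligation. by apply: owc_homP; apply: opd_homP. Qed.
Next Obligation. by apply: owc_homP; apply: opd_homP. Qed.

Definition V (i j : nat) : functor (OWC i j) (Opd j) :=
  @Functor (OWC i j) (Opd j) (@owc_opd T i j) (@owc_map T i j)
    (fun _ => erefl) (fun _ _ _ _ _ => erefl).

(* M leaves all dimensions of the underlying collection unchanged except k+1,
   and preserves the underlying k-operad structure: the unit, which is a
   morphism of collections and of k-operads, is the identity in every dimension
   other than k+1. *)
Definition unchanged_off_top (k : nat) (M : functor (Opd k) (Opd k.+1))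
    (MN : adjunction M (N k)) : Prop :=
  forall (X : opd_obj T k) (n : nat), n <> k.+1 ->
  exists e : X n = (M X : opd_obj T k.+1) n,
  forall x : X n,
    (adj_unit MN X : opd_hom X (opd_restr (M X))) n x = eq_rect _ id x _ e.

End Categories.

(* Main.v *)
Require Import Defs.
From mathcomp Require Import all_boot.
From Stdlib Require Import ProofIrrelevance.

(** The contraction cells of an object of [OWC T k.+1 k] have dimension at most
k+1, but they are indexed by parallel pairs of cells of dimension at most k.
The unit of [M -| N] is invertible in those dimensions, so along it a
contraction on X can be carried over to M X: move the pair back to X, contract
it there, and send the resulting cell forward.  That last step is harmless in
dimension k+1, where the unit need not be invertible.

The contraction obtained in this way ([push_ctr]) has a universal property:
the unit X -> M X preserves it, and a morphism h out of M X preserves it as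
soon as the composite of h with the unit preserves the contraction of X
([push_ctr_univ]); in other words, the unit is cocartesian over the functor
forgetting contractions.  Hence F X is M X with the pushed contraction, and
each datum of [M -| N] lifts because its composite with the unit is
visibly contraction preserving: for M f this composite is the unit after f, by
naturality, and for the counit it is the identity, by a triangle identity.
Since V and V' are faithful and nothing but contractions was added, all the
equations of the adjunction and both commutations are inherited. *)

Set Implicit Arguments.
Unset Strict Implicit.
Unset Printing Implicit Defensive.

#[local] Obligation Tactic := intros; simpl.

(** The inverse is produced as data, although [h] is a mere existence statement,
because an equality of types is a proposition: it can be extracted from [h] and
transported along while a type is still being built. *)
Lemma cast_inverse (A B : Type) (f : A -> B)
    (h : exists e : A = B, forall x, f x = eq_rect _ id x _ e) :
  {g : B -> A | cancel f g & cancel g f}.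
Proof.
have e : A = B by case: h.
subst B; have fE x : f x = x.
  by case: h => e ->; rewrite (proof_irrelevance _ e erefl).
by exists id => x; rewrite fE.
Qed.

Section Push.
Context (T : free_monad) (i : nat).

Lemma ctr_congr (X : coll T) (c : contraction i X) m (lt : m < i) (a b a' b' : X m)
    (par : parallel a b) (par' : parallel a' b') th hs ht hs' ht' :
  a = a' -> b = b' ->
  ctr c lt par (th := th) hs ht = ctr c lt par' (th := th) hs' ht'.
Proof.
move=> ea eb; subst a' b'.
by rewrite (proof_irrelevance _ par par') (proof_irrelevance _ hs hs')
           (proof_irrelevance _ ht ht').
Qed.

Context (X Y : coll T) (u : coll_hom X Y).
Context (inv : forall n, n < i -> {v : Y n -> X n | cancel (u n) v & cancel v (u n)}).

Definition back n (lt : n < i) : Y n -> X n := s2val (inv lt).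

Lemma back_can n (lt : n < i) : cancel (u n) (back lt).
Proof. exact: s2valP (inv lt). Qed.

Lemma can_back n (lt : n < i) : cancel (back lt) (u n).
Proof. exact: s2valP' (inv lt). Qed.

Lemma back_parallel n (lt : n < i) (a b : Y n) :
  parallel a b -> parallel (back lt a) (back lt b).
Proof.
case: n lt a b => [//|n] lt a b [hs ht].
have inj := can_inj (back_can (ltnW lt)).
by split; apply: inj; rewrite ?gmap_src ?gmap_tgt !can_back.
Qed.

Lemma arity_back n (lt : n < i) (a : Y n) : arity X n (back lt a) = arity Y n a.
Proof. by rewrite -(cmap_arity u) can_back. Qed.

Context (c : contraction i X).

Program Definition push_ctr : contraction i Y :=
  @Contraction T i Y
    (fun m lt a b par th hs ht =>
       u m.+1 (ctr c lt (back_parallel lt par) (th := th)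
                 (etrans hs (esym (arity_back lt a)))
                 (etrans ht (esym (arity_back lt b))))) _ _ _.
Next Obligation. by rewrite -gmap_src ctr_src can_back. Qed.
Next Obligation. by rewrite -gmap_tgt ctr_tgt can_back. Qed.
Next Obligation. by rewrite cmap_arity ctr_arity. Qed.

Lemma push_ctr_preserved : preserves_ctr c push_ctr u.
Proof.
move=> m lt a b par th hs ht par' hs' ht' /=; congr (u m.+1 _).
by apply: ctr_congr; rewrite back_can.
Qed.

(** A contraction cell of [push_ctr] is by construction the image of one of [c],
so [hu] decides where [h] sends it. *)
Lemma push_ctr_univ (Z : coll T) (d : contraction i Z) (h : coll_hom Y Z)
    (hu : coll_hom X Z) :
  hu = ccomp h u -> preserves_ctr c d hu -> preserves_ctr push_ctr d h.
Proof.
move=> -> hp m lt a b par th hs ht par' hs' ht' /=.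
have ps x : src th = arity Y m x -> src th = arity Z m (h m (u m (back lt x))).
  by rewrite can_back cmap_arity.
have pt x : tgt th = arity Y m x -> tgt th = arity Z m (h m (u m (back lt x))).
  by rewrite can_back cmap_arity.
have par2 : parallel (h m (u m (back lt a))) (h m (u m (back lt b))).
  by rewrite !can_back.
rewrite [LHS](hp m lt _ _ _ th _ _ par2 (ps a hs) (pt b ht)).
by apply: ctr_congr; rewrite /= can_back.
Qed.

End Push.

Lemma functor_eq (C D : category) (F : C -> D)
    (f : forall x y : C, hom x y -> hom (F x) (F y)) i1 i2 c1 c2 :
  @Functor C D F f i1 c1 = @Functor C D F f i2 c2.
Proof. by rewrite (proof_irrelevance _ i1 i2) (proof_irrelevance _ c1 c2). Qed.

Section Lift.
Context (T : free_monad) (k : nat).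
Context (M : functor (Opd T k) (Opd T k.+1)) (MN : adjunction M (N T k)).
Context (hM : unchanged_off_top MN).

Definition unit_map (X : opd_obj T k) : opd_hom X (opd_restr (M X)) := adj_unit MN X.

Lemma low_neq n : n < k.+1 -> n <> k.+1.
Proof. by move=> + e; rewrite e ltnn. Qed.

Definition unit_inv (X : opd_obj T k) n (lt : n < k.+1) :=
  cast_inverse (hM X (low_neq lt)).

Definition lift_ob (X : OWC T k.+1 k) : OWC T k.+1 k.+1 :=
  @OwcObj T k.+1 k.+1 (M (owc_opd X))
    (push_ctr (u := unit_map X) (unit_inv X) (owc_ctr X)).

Definition lift_unit (X : OWC T k.+1 k) : hom X (G T k.+1 k (lift_ob X)) :=
  @OwcHom T k.+1 k X (owc_restr (lift_ob X)) (unit_map X)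
    (push_ctr_preserved (u := unit_map X) _ _).

(** The link between the two adjunctions: contraction preservation passes from
the transpose of [h] under [M -| N] to [h] itself.  The equation is taken at
the level of operad morphisms so that naturality and the triangle identity
of [MN] can be supplied for it verbatim. *)
Lemma lift_preserves (X : OWC T k.+1 k) (Z : OWC T k.+1 k.+1)
    (h : opd_hom (M (owc_opd X)) (owc_opd Z))
    (g : owc_hom X (owc_restr Z)) :
  owc_map g = opd_comp (opd_restr_map h) (unit_map X) ->
  preserves_ctr (owc_ctr (lift_ob X)) (owc_ctr Z) h.
Proof.
move=> e; apply: (push_ctr_univ _ _ (@owc_map_ctr T _ _ _ _ g)).
by rewrite e.
Qed.

Definition lift_map (X Y : OWC T k.+1 k) (f : hom X Y) : hom (lift_ob X) (lift_ob Y) :=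
  @OwcHom T k.+1 k.+1 (lift_ob X) (lift_ob Y) (fmap M (owc_map f))
    (@lift_preserves X (lift_ob Y) _ (owc_comp (lift_unit Y) f)
       (esym (adj_unit_nat MN (owc_map f)))).

Program Definition lift_functor : functor (OWC T k.+1 k) (OWC T k.+1 k.+1) :=
  @Functor (OWC T k.+1 k) (OWC T k.+1 k.+1) lift_ob lift_map _ _.
Next Obligation. by apply: owc_homP; exact: (fmap_id M). Qed.
Next Obligation. by apply: owc_homP; exact: (fmap_cmp M). Qed.

Definition lift_counit (Y : OWC T k.+1 k.+1) : hom (lift_ob (owc_restr Y)) Y :=
  @OwcHom T k.+1 k.+1 (lift_ob (owc_restr Y)) Y (adj_counit MN (owc_opd Y))
    (@lift_preserves (owc_restr Y) Y _ (owc_id (owc_restr Y))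
       (esym (adj_triangle_r MN (owc_opd Y)))).

Program Definition lift_adjunction : adjunction lift_functor (G T k.+1 k) :=
  @Adjunction _ _ lift_functor (G T k.+1 k) lift_unit lift_counit _ _ _ _.
Next Obligation. by apply: owc_homP; exact: (adj_unit_nat MN (owc_map f)). Qed.
Next Obligation. by apply: owc_homP; exact: (adj_counit_nat MN (owc_map g)). Qed.
Next Obligation. by apply: owc_homP; exact: (adj_triangle_l MN (owc_opd x)). Qed.
Next Obligation. by apply: owc_homP; exact: (adj_triangle_r MN (owc_opd y)). Qed.

End Lift.

Theorem lemma2p4 (T : free_monad) (k : nat)
    (M : functor (Opd T k) (Opd T k.+1)) (MN : adjunction M (N T k))
    (hM : unchanged_off_top MN) :
  exists (F : functor (OWC T k.+1 k) (OWC T k.+1 k.+1))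
         (FG : adjunction F (G T k.+1 k)),
    functor_comp (V T k.+1 k) (G T k.+1 k) = functor_comp (N T k) (V T k.+1 k.+1) /\
    functor_comp (V T k.+1 k.+1) F = functor_comp M (V T k.+1 k) /\
    (forall X : OWC T k.+1 k,
       hom_eq (fmap (V T k.+1 k) (adj_unit FG X)) (adj_unit MN (V T k.+1 k X))) /\
    (forall Y : OWC T k.+1 k.+1,
       hom_eq (fmap (V T k.+1 k.+1) (adj_counit FG Y))
              (adj_counit MN (V T k.+1 k.+1 Y))).
Proof.
exists (lift_functor hM), (lift_adjunction hM).
by split; [|split; [|split]]; [exact: functor_eq | exact: functor_eq | |] => ?;
  exact: hom_eq_refl.
Qed.
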